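(* For any symmetric probability measure $\mu$ on $\mathbb{R}$, $$\Gamma(\mu|\mathrm{b})\le\frac12D^*(\mu|\mathrm{b})^2\cdot\log\left(1+\frac{\Psi^*(\mu|\mathrm{b})}{D^*(\mu|\mathrm{b})^2}\right).$$
   Context: $\mathrm{b}=\frac12\delta_{-1}+\frac12\delta_{1}$ is the Rademacher distribution. For a symmetric probability measure $\mu$ on $\mathbb{R}$: $\Gamma(\mu|\mathrm{b})=\frac12\int x^2\,d\mu(x)-\int\log|x|\,d\mu(x)-\frac12\in[0,+\infty]$, understood as the integral $\int\left(\frac12x^2-\log|x|-\frac12\right)d\mu(x)$ of a nonnegative function; $\Psi^*(\mu|\mathrm{b})=\int\frac1{x^2}\,d\mu(x)+\int x^2\,d\mu(x)-2\in[0,+\infty]$ (with $1/0=+\infty$); $D^*(\mu|\mathrm{b})=\left(\int(x^2-1)^2\,d\mu(x)\right)^{1/2}\in[0,+\infty]$. Degenerate cases of the right-hand side: if $D^*(\mu|\mathrm{b})=0$ (i.e. $\mu=\mathrm{b}$) it is read as $0$; if $D^*(\mu|\mathrm{b})=+\infty$ it is read as its limit value $\frac12\Psi^*(\mu|\mathrm{b})$; if $0<D^*(\mu|\mathrm{b})<+\infty$ and $\Psi^*(\mu|\mathrm{b})=+\infty$ it is $+\infty$. *)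

(* Defs.v *)
From mathcomp Require Import all_boot all_order all_algebra.
From mathcomp Require Import all_classical all_reals all_analysis.

Set Implicit Arguments.
Unset Strict Implicit.
Unset Printing Implicit Defensive.

Import Order.TTheory GRing.Theory Num.Theory.

Local Open Scope classical_set_scope.
Local Open Scope ring_scope.
Local Open Scope ereal_scope.

Definition symmetric_measure (R : realType)
    (mu : probability (measurableTypeR R) R) : Prop :=
  forall A : set (measurableTypeR R), measurable A ->
    pushforward mu (-%R : measurableTypeR R -> measurableTypeR R) A = mu A.

(* In the names below the suffix "_b" recalls the reference measure, the
   Rademacher distribution b = (delta_(-1) + delta_1) / 2. *)

(* [lne 0 = -oo], so the integrand is +oo at x = 0; it is nonnegative, since
   x^2 - 1 - log (x^2) >= 0. *)
Definition Gamma_b (R : realType)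
    (mu : probability (measurableTypeR R) R) : \bar R :=
  \int[mu]_x ((2^-1 * x ^+ 2)%:E - lne (`|x|%R)%:E - (2^-1)%:E).

(* The inverse is the one of [\bar R], for which [0^-1 = +oo]. *)
Definition Psi_star_b (R : realType)
    (mu : probability (measurableTypeR R) R) : \bar R :=
  \int[mu]_x ((x ^+ 2)%:E)^-1 + \int[mu]_x (x ^+ 2)%:E - 2%:E.

Definition D_star_b (R : realType)
    (mu : probability (measurableTypeR R) R) : \bar R :=
  sqrte (\int[mu]_x ((x ^+ 2 - 1) ^+ 2)%:E).

(* D^2 / 2 * log (1 + Psi / D^2) for D, Psi in [0, +oo], extended by 0 at
   D = 0 and by its limit Psi / 2 at D = +oo. For 0 < D < +oo and Psi = +oo the
   generic formula evaluates to +oo, because [lne +oo = +oo]. *)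
Definition entropy_bound (R : realType) (D Psi : \bar R) : \bar R :=
  if D == 0 then 0
  else if D == +oo then (2^-1)%:E * Psi
  else (2^-1)%:E * D ^+ 2 * lne (1 + Psi / D ^+ 2).

(* Main.v *)
Require Import Defs.
From mathcomp Require Import all_boot all_order all_algebra.
From mathcomp Require Import all_classical all_reals all_analysis.
From mathcomp Require Import measurable_realfun ring lra.

(* With u = x^2, the weight w = (u - 1)^2 satisfies D^2 = \int w and
   Psi = \int w / u, since w / u = u + 1 / u - 2. By concavity of the logarithm,
   \int w log (1 + 1 / u) <= D^2 log (1 + Psi / D^2), so the theorem reduces to
   u - 1 - log u <= (u - 1)^2 log (1 + 1 / u) for u > 0. Jensen's inequality is
   replaced by integrating the tangent of log (1 + .) at s = Psi / D^2. *)

Import Order.TTheory GRing.Theory Num.Theory.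

Local Open Scope ring_scope.

(** * Scalar inequalities for the logarithm *)

Lemma le_of_derive_ge0 {R : realType} (f f' : R -> R) (a : R) :
  (forall x, a <= x -> is_derive x 1 f (f' x)) ->
  (forall x, a < x -> 0 <= f' x) ->
  forall x, a <= x -> f a <= f x.
Proof.
move=> df f'0 x ax; apply: (@ger0_derive1_ndecry _ f a) => // [y|y|].
- rewrite in_itv/= andbT => /ltW /df yd.
  exact: (@ex_derive _ _ _ _ _ _ _ yd).
- rewrite in_itv/= andbT => ay; rewrite derive1E.
  by rewrite (@derive_val _ _ _ _ _ _ _ (df _ (ltW ay))); exact: f'0.
- apply: derivable_within_continuous => y; rewrite in_itv/= andbT => /df.
  by move=> yd; exact: (@ex_derive _ _ _ _ _ _ _ yd).
Qed.

(** The left side is 2 - 4 / (t + 1). Its difference with [ln t] vanishes at 1, and ln t - left side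
    has derivative (t - 1)^2 / (t (t + 1)^2) >= 0. *)
Lemma ln_ge_pade {R : realType} (t : R) :
  1 <= t -> 2 * (t - 1) / (t + 1) <= ln t.
Proof.
move=> t1.
have : ln 1 + 4 * (1 + 1)^-1 <= ln t + 4 * (t + 1)^-1.
  apply: (@le_of_derive_ge0 _ (fun x => ln x + 4 * (x + 1)^-1)
    (fun x => x^-1 - 4 * (x + 1) ^- 2)) => // x x1.
  - have x0 : 0 < x by lra.
    have x10 : x + 1 != 0 by lra.
    have dln := is_derive1_ln x0.
    pose v (y : R) := (y + 1)^-1.
    have dv : is_derive x 1 v (- (x + 1) ^- 2 * (1 + 0)).
      by apply: (@is_deriveV _ (id + cst 1)) => //; exact: is_deriveD.
    have dlnv (c : R) :
        is_derive x 1 (fun y => ln y + c * v y) (x^-1 - c * (x + 1) ^- 2).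
      have := is_deriveD dln (is_deriveZ c dv).
      rewrite (_ : _ + _ *: _ = x^-1 - c * (x + 1) ^- 2) //.
      by rewrite /GRing.scale/=; ring.
    exact: dlnv.
  - have -> : x^-1 - 4 * (x + 1) ^- 2 = (x - 1) ^+ 2 / (x * (x + 1) ^+ 2).
      by field; lra.
    by rewrite divr_ge0 ?sqr_ge0// mulr_ge0 ?sqr_ge0//; lra.
rewrite ln1; have -> : 2 * (t - 1) / (t + 1) = 2 - 4 * (t + 1)^-1.
  by field; lra.
have -> : (1 + 1)^-1 = 2^-1 :> R by []. lra.
Qed.

(** Equality holds at 1, and right side minus left side has derivative (1 - 1 / t)^2 / 2 >= 0. *)
Lemma ln_le_halfB {R : realType} (t : R) : 1 <= t -> ln t <= (t - t^-1) / 2.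
Proof.
move=> t1.
have : (1 - 1^-1) / 2 - ln 1 <= (t - t^-1) / 2 - ln t.
  apply: (@le_of_derive_ge0 _ (fun x => (x - x^-1) / 2 - ln x)
    (fun x => (1 + x ^- 2) / 2 - x^-1)) => // x x1.
  - have x0 : 0 < x by lra.
    have x0' : x != 0 by lra.
    have dln := is_derive1_ln x0.
    pose v (y : R) := y^-1.
    have dv : is_derive x 1 v (- x ^- 2 * 1).
      exact: (@is_deriveV _ id).
    rewrite (_ : (fun _ => _) = 2^-1 *: (id - v) - @ln R).
      by apply: is_derive_eq; rewrite /GRing.scale/=; ring.
    by apply/funext => y; rewrite /GRing.scale/= mulrC.
  - have -> : (1 + x ^- 2) / 2 - x^-1 = (1 - x^-1) ^+ 2 / 2 by field; lra.
    by rewrite divr_ge0 ?sqr_ge0.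
rewrite ln1 invr1; lra.
Qed.

(** For u >= 1, [ln_ge_pade] bounds both logarithms and leaves a rational inequality. For u <= 1,
    where [ln u] diverges at 0, the multiples of [ln u] are collected first. *)
Lemma log_entropy_le {R : realType} (u : R) : 0 < u ->
  u - 1 - ln u <= (u - 1) ^+ 2 * ln (1 + u^-1).
Proof.
move=> u0; have ui0 : 0 < u^-1 by rewrite invr_gt0.
have [u1|/ltW u1] := leP 1 u.
- have H1 : 2 * (u - 1) / (u + 1) <= ln u by exact: ln_ge_pade.
  have H2 : 2 / (2 * u + 1) <= ln (1 + u^-1).
    have -> : 2 / (2 * u + 1) = 2 * (1 + u^-1 - 1) / (1 + u^-1 + 1).
      by field; lra.
    by apply: ln_ge_pade; lra.
  have : (u - 1) ^+ 2 * (2 / (2 * u + 1)) <= (u - 1) ^+ 2 * ln (1 + u^-1).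
    by rewrite ler_wpM2l ?sqr_ge0.
  apply: le_trans.
  (* This is exactly the slack left once both logarithms are replaced by their lower bounds. *)
  have : 0 <= (u - 1) ^+ 2 / ((2 * u + 1) * (u + 1)).
    by rewrite divr_ge0 ?sqr_ge0// mulr_ge0//; lra.
  have -> : (u - 1) ^+ 2 / ((2 * u + 1) * (u + 1)) =
    (u - 1) ^+ 2 * (2 / (2 * u + 1)) - (u - 1) + 2 * (u - 1) / (u + 1).
    by field; lra.
  by lra.
(* Since 1 - (u - 1)^2 = u (2 - u), the claim becomes - u (2 - u) ln u <= (1 - u) + (1 - u)^2 ln (1
   + u). *)
- have lnu : ln (1 + u^-1) = ln (1 + u) - ln u.
    rewrite -ln_div ?posrE//; last lra.
    by congr ln; field; lra.
  have H1 : - ln u <= (1 - u) * (1 + u) / (2 * u).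
    have -> : (1 - u) * (1 + u) / (2 * u) = (u^-1 - u^-1^-1) / 2.
      by field; lra.
    rewrite -lnV ?posrE//; apply: ln_le_halfB.
    by rewrite -invr1 lef_pV2 ?posrE.
  (* From ln y <= y - 1 at y = 1 / (1 + u): ln (1 + u) >= u / (1 + u) >= u / 2, as u <= 1. *)
  have H2 : u / 2 <= ln (1 + u).
    have : ln ((1 + u)^-1) <= (1 + u)^-1 - 1.
      have := @le_ln1Dx _ ((1 + u)^-1 - 1).
      rewrite addrCA subrr addr0; apply.
      by rewrite ltrBrDr addNr invr_gt0; lra.
    rewrite lnV ?posrE; last lra.
    have -> : (1 + u)^-1 - 1 = - (u / 2 * ((1 - u) / (1 + u))) - u / 2.
      by field; lra.
    have : 0 <= u / 2 * ((1 - u) / (1 + u)).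
      by rewrite mulr_ge0 ?divr_ge0//; lra.
    lra.
  have H3 : - ln u * (u * (2 - u)) <=
      (1 - u) * (1 + u) / (2 * u) * (u * (2 - u)).
    by rewrite ler_wpM2r// mulr_ge0//; lra.
  have E : (1 - u) * (1 + u) / (2 * u) * (u * (2 - u)) =
      (1 - u) + (1 - u) ^+ 2 * (u / 2) by field; lra.
  have H4 : (1 - u) ^+ 2 * (u / 2) <= (1 - u) ^+ 2 * ln (1 + u).
    by rewrite ler_wpM2l ?sqr_ge0.
  rewrite lnu; nra.
Qed.

(** Half of [log_entropy_le], with log (1 + 1 / u) replaced by its tangent at s, of slope 1 / (1 +
    s) = 2 c. The identity (u - 1)^2 / u = 1 / u + u - 2 brings in the integrand of Psi, and
    negative terms are moved across so that both sides are sums of nonnegative terms. *)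
Lemma log_entropy_tangent {R : realType} (s u : R) (c := (2 * (1 + s))^-1) :
  0 <= s -> 0 < u ->
  (u - 1 - ln u) / 2 + 2 * c + c * s * (u - 1) ^+ 2 <=
  ln (1 + s) / 2 * (u - 1) ^+ 2 + c * (u^-1 + u).
Proof.
move=> s0 u0; have ui0 : 0 < u^-1 by rewrite invr_gt0.
have tangent : ln (1 + u^-1) <= ln (1 + s) + 2 * c * (u^-1 - s).
  (* The tangent bound is ln y <= y - 1 at y = (1 + 1 / u) / (1 + s). *)
  have := @le_ln1Dx _ ((1 + u^-1) / (1 + s) - 1).
  rewrite addrCA subrr addr0 ltrBrDr addNr divr_gt0; try lra.
  move=> /(_ isT); rewrite ln_div ?posrE; try lra.
  have -> : (1 + u^-1) / (1 + s) - 1 = 2 * c * (u^-1 - s).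
    by rewrite /c; field; lra.
  by lra.
have := log_entropy_le _ u0.
have : (u - 1) ^+ 2 * ln (1 + u^-1) <=
    (u - 1) ^+ 2 * (ln (1 + s) + 2 * c * (u^-1 - s)).
  by rewrite ler_wpM2l ?sqr_ge0.
have -> : (u - 1) ^+ 2 * (ln (1 + s) + 2 * c * (u^-1 - s)) =
    ln (1 + s) * (u - 1) ^+ 2 + 2 * c * (u^-1 + u - 2)
    - 2 * c * s * (u - 1) ^+ 2 by field; lra.
by lra.
Qed.

(* Integration of pointwise bounds *)
Local Close Scope ring_scope.
Local Open Scope ereal_scope.

(** The integrand of [Gamma_b] as a function of x^2. The value at 0 is set separately because the
    real-valued [ln] is finite there. *)
Definition gamma_density {R : realType} (x : R) : \bar R :=
  if x == 0%R then +oo else ((x ^+ 2 - 1 - ln (x ^+ 2)) / 2)%:E.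

Lemma Gamma_bE {R : realType} (mu : probability (measurableTypeR R) R) :
  Gamma_b mu = \int[mu]_x gamma_density x.
Proof.
apply: eq_integral => x _; rewrite /gamma_density; case: eqVneq => [->|x0].
  by rewrite normr0 le0_lneNy.
have x20 : (0 < `|x|)%R by rewrite normr_gt0.
rewrite lne_EFin// -EFinB; congr (_%:E).
have -> : (x ^+ 2 = `|x| ^+ 2)%R by rewrite real_normK// num_real.
by rewrite lnXn// mulr2n; field.
Qed.

Lemma gamma_density_ge0 {R : realType} (x : R) : 0 <= gamma_density x.
Proof.
rewrite /gamma_density; case: eqVneq => // x0; rewrite lee_fin.
have x20 : (0 < x ^+ 2)%R by rewrite exprn_even_gt0.
have := @le_ln1Dx _ (x ^+ 2 - 1)%R; rewrite addrCA subrr addr0.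
by lra.
Qed.

Lemma measurable_gamma_density {R : realType} :
  @measurable_fun _ _ (measurableTypeR R) (\bar R) setT gamma_density.
Proof.
apply: measurable_fun_ifT => //; first exact: measurable_fun_eqr.
apply/measurable_EFinP; apply: measurable_funM => //.
apply: measurable_funB; first exact: measurable_funB.
by apply: (measurableT_comp (@measurable_ln R)); exact: measurable_funX.
Qed.

Lemma measurable_inve_sqr {R : realType} :
  @measurable_fun _ _ (measurableTypeR R) (\bar R) setT
    (fun x => ((x ^+ 2)%:E)^-1).
Proof.
(* Away from 0 the inverse is the real power of exponent -1, whose measurability is known. *)
rewrite (_ : (fun _ => _) =
    fun x : R => if x == 0%R then +oo else (((x ^+ 2) `^ (-1))%R)%:E).
  apply: measurable_fun_ifT.
  - exact: measurable_fun_eqr.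
  - by [].
  - apply/measurable_EFinP.
    by apply: (measurableT_comp (measurable_powR _)); exact: measurable_funX.
by apply/funext => x; rewrite inver sqrf_eq0 powR_inv1 ?sqr_ge0.
Qed.

(* Keeping every term nonnegative allows all the integrals to be infinite. *)
Lemma Gamma_b_le {R : realType} (mu : probability (measurableTypeR R) R)
    (k a b c : R) :
  (0 <= k)%R -> (0 <= a)%R -> (0 <= b)%R -> (0 < c)%R ->
  (forall u : R, 0 < u -> (u - 1 - ln u) / 2 + k + a * (u - 1) ^+ 2 <=
    b * (u - 1) ^+ 2 + c * (u^-1 + u))%R ->
  Gamma_b mu + k%:E + a%:E * \int[mu]_x ((x ^+ 2 - 1) ^+ 2)%:E <=
  b%:E * \int[mu]_x ((x ^+ 2 - 1) ^+ 2)%:E +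
  c%:E * (\int[mu]_x ((x ^+ 2)%:E)^-1 + \int[mu]_x (x ^+ 2)%:E).
Proof.
move=> k0 a0 b0 c0 le_ptw.
pose T : measurableType _ := measurableTypeR R.
pose W (x : T) := ((x ^+ 2 - 1) ^+ 2)%:E.
pose I (x : T) := ((x ^+ 2)%:E)^-1.
pose U (x : T) := (x ^+ 2)%:E.
have W0 x : setT x -> 0 <= W x by move=> _; rewrite lee_fin sqr_ge0.
have I0 x : setT x -> 0 <= I x by move=> _; rewrite inve_ge0 lee_fin sqr_ge0.
have U0 x : setT x -> 0 <= U x by move=> _; rewrite lee_fin sqr_ge0.
have mU : measurable_fun setT U.
  by apply/measurable_EFinP; exact: (@measurable_funX _ T R).
have mI : measurable_fun setT I by exact: measurable_inve_sqr.
have mW : measurable_fun setT W.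
  apply/measurable_EFinP; apply: (@measurable_funX _ T R).
  by apply: (@measurable_funB _ T R).
have mG : @measurable_fun _ _ T (\bar R) setT gamma_density.
  exact: measurable_gamma_density.
have G0 (x : R) : setT x -> 0 <= gamma_density x.
  by move=> _; exact: gamma_density_ge0.
have mT : measurable (setT : set T) by [].
have IU0 x : setT x -> 0 <= I x + U x by move=> _; rewrite adde_ge0 ?I0 ?U0.
have mIU : measurable_fun setT (fun x => I x + U x) by exact: emeasurable_funD.
have mZ (r : R) (f : T -> \bar R) : measurable_fun setT f ->
  measurable_fun setT (fun x => r%:E * f x).
  exact: measurable_funeM.
have Z0 (r : R) (f : T -> \bar R) : (0 <= r)%R ->
    (forall x, setT x -> 0 <= f x) -> forall x, setT x -> 0 <= r%:E * f x.
  by move=> r0 f0 x xT; rewrite mule_ge0 ?lee_fin ?f0.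
have Gk0 (x : R) : setT x -> 0 <= gamma_density x + k%:E.
  by move=> xT; rewrite adde_ge0 ?lee_fin ?G0.
have mGk : measurable_fun setT (fun x : T => gamma_density x + k%:E).
  exact: emeasurable_funD.
have intk : k%:E = \int[mu]_x k%:E.
  by rewrite (integral_cst mu mT)/= probability_setT mule1.
rewrite Gamma_bE [in leLHS]intk.
rewrite -(ge0_integralD mu mT I0 mI U0 mU).
rewrite -(ge0_integralZl_EFin mu mT IU0 mIU (ltW c0)).
rewrite -(ge0_integralZl_EFin mu mT W0 mW a0).
rewrite -(ge0_integralZl_EFin mu mT W0 mW b0).
rewrite -(ge0_integralD mu mT G0 mG) //.
rewrite -(ge0_integralD mu mT Gk0 mGk (Z0 _ _ a0 W0) (mZ _ _ mW)).
rewrite -(ge0_integralD mu mT (Z0 _ _ b0 W0) (mZ _ _ mW)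
  (Z0 _ _ (ltW c0) IU0) (mZ _ _ mIU)).
apply: ge0_le_integral => //.
- by move=> x xT; rewrite adde_ge0 ?Gk0 ?Z0.
- by apply: emeasurable_funD => //; exact: mZ.
- by apply: emeasurable_funD => //; exact: mZ.
move=> x _; rewrite /W /I /U /gamma_density.
(* At 0 both sides are +oo; on the right this relies on c > 0. *)
have [->|x0] := eqVneq x 0%R.
  by rewrite expr0n/= inver eqxx !addye// gt0_muley ?lte_fin//.
rewrite inver sqrf_eq0 (negbTE x0) -!EFinM -!EFinD lee_fin.
by apply: le_ptw; rewrite exprn_even_gt0.
Qed.

(** A nonnegative function with zero integral vanishes almost everywhere, so x^2 = 1 for almost
    every x, and there [gamma_density] is 0. *)
Lemma Gamma_b_eq0 {R : realType} (mu : probability (measurableTypeR R) R) :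
  \int[mu]_x ((x ^+ 2 - 1) ^+ 2)%:E = 0 -> Gamma_b mu = 0.
Proof.
pose T : measurableType _ := measurableTypeR R.
have mW : @measurable_fun _ _ T _ setT (fun x : T => (x ^+ 2 - 1) ^+ 2)%R.
  by apply: (@measurable_funX _ T R); apply: (@measurable_funB _ T R).
move=> W_eq0; rewrite Gamma_bE.
rewrite -[RHS](@integral0 _ T R mu setT).
apply: ge0_ae_eq_integral => //.
- exact: measurable_gamma_density.
- by move=> x _; exact: gamma_density_ge0.
have : \int[mu]_x `|((x ^+ 2 - 1) ^+ 2)%:E| = 0.
  rewrite -[RHS]W_eq0; apply: eq_integral => x _.
  by rewrite gee0_abs ?lee_fin ?sqr_ge0.
move/(ae_eq_integral_abs mu measurableT _).1.
move=> /(_ ltac:(exact/measurable_EFinP)).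
apply: filterS => x /(_ I) [] /eqP.
rewrite sqrf_eq0 subr_eq0 => /eqP x21 _; rewrite /gamma_density.
case: eqVneq x21 => [->|_ ->].
  by move=> /eqP; rewrite expr0n/= eq_sym oner_eq0.
by rewrite subrr ln1 subrr mul0r.
Qed.

(** * Cases on D and Psi, and the choice of the tangent point *)

Theorem theorem3p9 (R : realType) (mu : probability (measurableTypeR R) R)
    (mu_sym : symmetric_measure mu) :
  Gamma_b mu <= entropy_bound (D_star_b mu) (Psi_star_b mu).
Proof.
rewrite /entropy_bound /D_star_b /Psi_star_b.
set D2 := \int[mu]_x ((x ^+ 2 - 1) ^+ 2)%:E.
set I := \int[mu]_x _^-1; set U := \int[mu]_x (x ^+ 2)%:E.
have D20 : 0 <= D2 by apply: integral_ge0 => x _; rewrite lee_fin sqr_ge0.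
have I0 : 0 <= I.
  by apply: integral_ge0 => x _; rewrite inve_ge0 lee_fin sqr_ge0.
have U0 : 0 <= U by apply: integral_ge0 => x _; rewrite lee_fin sqr_ge0.
have G0 : 0 <= Gamma_b mu.
  by rewrite Gamma_bE; apply: integral_ge0 => x _; exact: gamma_density_ge0.
have ln_ge (u : R) : (0 < u -> 1 - u^-1 <= ln u)%R.
  move=> u0; have := @le_ln1Dx _ (u^-1 - 1)%R.
  rewrite addrCA subrr addr0 lnV ?posrE// ltrBrDr addNr invr_gt0 => /(_ u0).
  by lra.
(* With these constants the pointwise hypothesis reduces to 1 - 1 / u <= ln u. The resulting bound
   Gamma <= Psi / 2 settles D = +oo and also shows Psi >= 0. *)
have G_le_half : Gamma_b mu + 1%:E <= (2^-1)%:E * (I + U).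
  have := @Gamma_b_le _ mu 1 0 0 2^-1.
  rewrite !mul0e add0e adde0; apply => // u u0.
  have := ln_ge _ u0; lra.
have PsiE : (2^-1)%:E * (I + U - 2%:E) = (2^-1)%:E * (I + U) - 1%:E.
  rewrite muleBr//; first by rewrite -EFinM mulVf.
  by rewrite fin_num_adde_defl.
have G_le_Psi : Gamma_b mu <= (2^-1)%:E * (I + U - 2%:E).
  by rewrite PsiE leeBrDr.
have Psi0 : 0 <= I + U - 2%:E.
  have := le_trans G0 G_le_Psi; rewrite pmule_rge0// lte_fin; lra.
rewrite (sqr_sqrte D20).
case: eqP => [D0|/eqP D_neq0].
  rewrite Gamma_b_eq0// -/D2 -(sqr_sqrte D20) D0.
  by rewrite expe2 mule0.
case: eqP => // /eqP D_neqy.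
move: D20 D_neq0 D_neqy.
move ED2 : D2 => [d||//]; last by move=> _ _ /eqP.
move=> d0 d_neq0 _.
have {d0 d_neq0} d0 : (0 < d)%R.
  rewrite lt_def -lee_fin d0 andbT; apply: contraNneq d_neq0 => ->.
  by rewrite sqrte0.
(* Here 0 < D^2 = d < +oo, so Psi = +oo makes the bound infinite. *)
have infinite_case : I + U = +oo ->
    Gamma_b mu <= (2^-1)%:E * d%:E * lne (1 + (I + U - 2%:E) / d%:E).
  move=> ->; rewrite (_ : +oo - 2%:E = +oo)// inver gt_eqF//.
  rewrite gt0_mulye ?lte_fin ?invr_gt0// addey//=.
  by rewrite gt0_muley ?leey// -EFinM lte_fin mulr_gt0.
move EI : I I0 => [i||] // I0; last first.
  rewrite -EI; apply: infinite_case.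
  by rewrite EI addye// gt_eqF// (lt_le_trans _ U0).
move EU : U U0 => [v||] // U0; last first.
  by rewrite -EI -EU; apply: infinite_case; rewrite EI EU.
move: Psi0; rewrite EI EU -!EFinD lee_fin inver gt_eqF// -EFinM -EFinD => Psi0.
(* All integrals on the right are now finite; the tangent is taken at s = Psi / D^2, the mean of 1 /
   u under the weight (u - 1)^2. *)
pose s := ((i + v - 2) / d)%R.
have s0 : (0 <= s)%R by rewrite divr_ge0// ltW.
have sd : (s * d = i + v - 2)%R by rewrite mulfVK// gt_eqF.
have s10 : (0 < 1 + s)%R by lra.
rewrite -/s lne_EFin//.
have L0 : (0 <= ln (1 + s))%R by apply: ln_ge0; lra.
pose c := ((2 * (1 + s))^-1)%R.
have c0 : (0 < c)%R by rewrite invr_gt0 mulr_gt0.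
have : Gamma_b mu + (2 * c)%:E + (c * s)%:E * D2 <=
    (ln (1 + s) / 2)%:E * D2 + c%:E * (I + U).
  apply: Gamma_b_le => [||||u u0] //.
  - by rewrite mulr_ge0// ltW.
  - by rewrite mulr_ge0 ?(ltW c0).
  - by rewrite divr_ge0.
  - exact: log_entropy_tangent.
rewrite ED2 EI EU -(EFinD i v) -!EFinM -addeA -!EFinD -leeBrDr// -EFinB.
(* By the choice of s, i + v - 2 = s d, so all terms in c cancel: the tangent bound is exact after
   integration. *)
rewrite (_ : _ - _ = 2^-1 * d * ln (1 + s))%R//.
have -> : (i + v = s * d + 2)%R by rewrite sd subrK.
by rewrite -/c; clearbody c s; field.
Qed.
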